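(* Let $A,B$ be finite-dimensional quantum systems, let $\mathcal{E}_{B|A}$ be a quantum operation (completely positive trace-preserving map) from $A$ to $B$, and let $\epsilon\in[0,1]$. For every state $\rho_A$ of $A$, $$\log M^{\mathrm{E}}_{\epsilon}(\mathcal{E}_{B|A},\rho_A)\;\le\; I^{\mathrm{ALL}}_{\epsilon}(\mathcal{E}_{B|A},\rho_A),$$ and consequently $$\log M^{\mathrm{E}}_{\epsilon}(\mathcal{E}_{B|A})\;\le\;\max_{\rho_A\in\mathrm{states}(A)} I^{\mathrm{ALL}}_{\epsilon}(\mathcal{E}_{B|A},\rho_A).$$ Here $M^{\mathrm{E}}_\epsilon$ is the maximal size of entanglement-assisted codes and $I^{\mathrm{ALL}}_\epsilon$ is the hypothesis-testing quantity, both defined in the context.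
   Context: All systems are finite-dimensional, each with a fixed orthonormal (''classical'') basis $\{|i\rangle\}$. $\mathrm{states}(Q)$ is the set of density operators on $\mathcal{H}_Q$. Tensor products and identity maps on other systems are omitted. Canonical purification. For a state $\rho_A$, let $\tilde A$ be a copy of $A$, $\Phi_{\tilde A A}:=\sum_{i,j}|i\rangle_{\tilde A}|i\rangle_A\langle j|_{\tilde A}\langle j|_A$, $\rho_{\tilde A A}:=\rho_A^{1/2}\Phi_{\tilde AA}\rho_A^{1/2}$ and $\rho_{\tilde A}:=\mathrm{Tr}_A\,\rho_{\tilde AA}$ (the transpose of $\rho_A$ in the classical basis, regarded as an operator on $\tilde A$). Hypothesis testing. For states $\tau^{(0)},\tau^{(1)}$ of a system $Q$, $\beta^{\mathrm{ALL}}_\epsilon(\tau^{(0)}\|\tau^{(1)}):=\min\{\mathrm{Tr}\,\tau^{(1)}T:\ 0\le T\le \mathbb{1},\ \mathrm{Tr}\,\tau^{(0)}T\ge 1-\epsilon\}$ and $D^{\mathrm{ALL}}_\epsilon:=-\log\beta^{\mathrm{ALL}}_\epsilon$ (with $-\log 0=+\infty$). Define $$I^{\mathrm{ALL}}_\epsilon(\mathcal{E}_{B|A},\rho_A):=\min_{\sigma_B\in\mathrm{states}(B)}D^{\mathrm{ALL}}_\epsilon(\mathcal{E}_{B|A}\rho_{\tilde AA}\,\|\,\rho_{\tilde A}\otimes\sigma_B).$$ Codes. An entanglement-assisted code of size $M$ (for channels from $A$ to $B$) consists of finite-dimensional systems $A_E$ (sender) and $B_E$ (receiver), a state $\Psi_{A_EB_E}$,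 for each message $w\in\{1,\dots,M\}$ an encoding operation (CPTP map) $\mathcal{C}(w)_{A|A_E}$, and a decoding POVM $\{D(\hat w)_{B_EB}\}_{\hat w=1}^{M}$ on $B_EB$. When used with $\mathcal{E}_{B|A}$, $\Pr(\hat W=\hat w|W=w)=\mathrm{Tr}\,D(\hat w)_{B_EB}\,\mathcal{E}_{B|A}\mathcal{C}(w)_{A|A_E}\Psi_{A_EB_E}$. It is an $(M,\epsilon,\rho_A)$ code for $\mathcal{E}$ if, for equiprobable messages, the error probability satisfies $\Pr(\hat W\ne W)\le\epsilon$ and the average channel input state $\frac1M\sum_w \mathrm{Tr}_{B_E}\,\mathcal{C}(w)_{A|A_E}\Psi_{A_EB_E}$ equals $\rho_A$. $M^{\mathrm{E}}_\epsilon(\mathcal{E}_{B|A},\rho_A)$ is the largest $M$ for which there is an $(M,\epsilon,\rho_A)$ entanglement-assisted code for $\mathcal{E}$ (understood as a supremum, possibly $+\infty$), and $M^{\mathrm{E}}_\epsilon(\mathcal{E}_{B|A})$ is the largest $M$ for which such a code exists for some $\rho_A$. *)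

(* Defs.v *)
From HB Require Import structures.
From mathcomp Require Import all_boot all_order all_algebra.
From mathcomp Require Import complex mxtens.
From mathcomp Require Import all_classical all_reals ereal exp.

Set Implicit Arguments.
Unset Strict Implicit.
Unset Printing Implicit Defensive.

Import Order.TTheory GRing.Theory Num.Theory.

Local Open Scope classical_set_scope.
Local Open Scope ring_scope.
Local Open Scope complex_scope.
Local Open Scope sesquilinear_scope.

(* A system of dimension n has classical basis indexed by 'I_n and its         *)
(* operators are 'M[R[i]]_n.  A composite system is 'M[R[i]]_(m * n), indexed  *)
(* through mxtens_index, so that A *t B is the operator A (x) B.  The factors  *)
(* are ordered so that the one a map acts on comes second: the composite       *)
(* systems met below are (~A, A), (~A, B), (B_E, A_E), (B_E, A) and (B_E, B).  *)

Section Operators.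
Variable R : realType.
Local Notation C := R[i].

(* On R[i], 0 <= z means that z is real and nonnegative; positivity of the     *)
(* quadratic form on all complex vectors forces A to be Hermitian.             *)
Definition psd n (A : 'M[C]_n) : Prop :=
  forall v : 'cV[C]_n, 0 <= (v^t* *m A *m v) 0 0.

Definition states n : set 'M[C]_n := [set A | psd A /\ \tr A = 1].

Definition ptrace1 m n (X : 'M[C]_(m * n)) : 'M[C]_n :=
  \matrix_(p, q) \sum_(i < m) X (mxtens_index (i, p)) (mxtens_index (i, q)).

Definition ptrace2 m n (X : 'M[C]_(m * n)) : 'M[C]_m :=
  \matrix_(i, j) \sum_(p < n) X (mxtens_index (i, p)) (mxtens_index (j, p)).

(* id_k (x) N, where <i| (id_k (x) N)(X) |j> = N (<i| X |j>) for i, j in the   *)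
(* basis of the first factor.                                                  *)
Definition idtens k m n (N : 'M[C]_m -> 'M[C]_n) (X : 'M[C]_(k * m)) :
    'M[C]_(k * n) :=
  \matrix_(r, s)
    N (\matrix_(p, q) X (mxtens_index ((mxtens_unindex r).1, p))
                        (mxtens_index ((mxtens_unindex s).1, q)))
      (mxtens_unindex r).2 (mxtens_unindex s).2.

Definition cptp m n (N : {linear 'M[C]_m -> 'M[C]_n}) : Prop :=
  (forall k (X : 'M[C]_(k * m)), psd X -> psd (idtens N X)) /\
  (forall X : 'M[C]_m, \tr (N X) = \tr X).

(* The square root by functional calculus; it is meant for psd matrices.       *)
Definition sqrtmx n (A : 'M[C]_n) : 'M[C]_n :=
  invmx (spectralmx A) *m diag_mx (map_mx sqrtC (spectral_diag A))
    *m spectralmx A.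

(* sum_(i, j) |i><j| (x) |i><j| *)
Definition Phi n : 'M[C]_(n * n) :=
  \sum_(i < n) \sum_(j < n) delta_mx i j *t delta_mx i j.

Definition purification n (rho : 'M[C]_n) : 'M[C]_(n * n) :=
  (1%:M *t sqrtmx rho) *m Phi n *m (1%:M *t sqrtmx rho).

End Operators.

Section HypothesisTesting.
Variable R : realType.
Local Notation C := R[i].
Local Open Scope ereal_scope.

(* Minima and maxima are rendered by ereal_inf and ereal_sup; those over tests *)
(* and states are attained, by compactness.                                    *)

(* The traces below are real (products of psd operators), so Re only changes   *)
(* the type.                                                                   *)
Definition tests n (eps : R) (tau0 : 'M[C]_n) : set 'M[C]_n :=
  [set T | [/\ psd T, psd (1%:M - T)%R &
             (1 - eps <= complex.Re (\tr (tau0 *m T)))%R]].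

Definition betaALL n (eps : R) (tau0 tau1 : 'M[C]_n) : \bar R :=
  ereal_inf [set (complex.Re (\tr (tau1 *m T)))%:E | T in tests eps tau0].

(* Logarithms are natural, extended by log 0 = -oo and log +oo = +oo; a change *)
(* of base rescales both sides of the bounds alike.                            *)
Definition DALL n (eps : R) (tau0 tau1 : 'M[C]_n) : \bar R :=
  - lne (betaALL eps tau0 tau1).

Definition IALL m n (eps : R) (E : {linear 'M[C]_m -> 'M[C]_n})
    (rho : 'M[C]_m) : \bar R :=
  ereal_inf [set DALL eps (idtens E (purification rho))
                          (ptrace2 (purification rho) *t sigma)
            | sigma in @states R n].

End HypothesisTesting.

Section Codes.
Variable R : realType.
Local Notation C := R[i].

Record ea_code (dA dB M : nat) := EACode {
  dAE : nat;
  dBE : nat;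
  shared : 'M[C]_(dBE * dAE);
  enc : 'I_M -> {linear 'M[C]_dAE -> 'M[C]_dA};
  dec : 'I_M -> 'M[C]_(dBE * dB);
  shared_state : states shared;
  enc_cptp : forall w, cptp (enc w);
  dec_psd : forall w, psd (dec w);
  dec_sum : \sum_w dec w = 1%:M
}.

Variables (dA dB M : nat).
Implicit Types (K : ea_code dA dB M) (E : {linear 'M[C]_dA -> 'M[C]_dB}).

Definition encoded K (w : 'I_M) : 'M[C]_(dBE K * dA) :=
  idtens (enc K w) (shared K).

(* Pr(W^ = what | W = w) *)
Definition prob K E (what w : 'I_M) : R :=
  complex.Re (\tr (dec K what *m idtens E (encoded K w))).

Definition error_prob K E : R :=
  M%:R^-1 * \sum_w \sum_(what | what != w) prob K E what w.

Definition avg_input K : 'M[C]_dA :=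
  M%:R^-1 *: \sum_w ptrace1 (encoded K w).

End Codes.

Section MaximalSize.
Variable R : realType.
Local Notation C := R[i].
Variables (dA dB : nat).
Local Open Scope ereal_scope.

Definition has_code (eps : R) (E : {linear 'M[C]_dA -> 'M[C]_dB})
    (rho : 'M[C]_dA) (M : nat) : Prop :=
  (0 < M)%N /\
  exists K : ea_code R dA dB M, (error_prob K E <= eps)%R /\ avg_input K = rho.

Definition ME_input (eps : R) (E : {linear 'M[C]_dA -> 'M[C]_dB})
    (rho : 'M[C]_dA) : \bar R :=
  ereal_sup [set (M%:R)%:E | M in [set M : nat | has_code eps E rho M]].

Definition ME (eps : R) (E : {linear 'M[C]_dA -> 'M[C]_dB}) : \bar R :=
  ereal_sup [set (M%:R)%:E | M in
    [set M : nat | exists2 rho, states rho & has_code eps E rho M]].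

End MaximalSize.

(* Main.v *)
(* For a code of size M with average input rho, put X_w = (1/M) C(w) Psi. The X_w
   extend rho, so they arise from the canonical purification of rho by measuring
   the purifying system. Measuring in this way and then decoding is a test. On
   the purification after the channel it accepts with the success probability of
   the code; on the product alternative the output is independent of the message
   and of the receiver's share, so the test accepts with probability 1/M. Hence
   beta_eps <= 1/M for every sigma. *)
From HB Require Import structures.
Require Import Defs.
From mathcomp Require Import all_boot all_order all_algebra.
From mathcomp Require Import complex mxtens.
From mathcomp Require Import all_classical all_reals ereal exp.

Set Implicit Arguments.
Unset Strict Implicit.
Unset Printing Implicit Defensive.

Import Order.TTheory GRing.Theory Num.Theory.

Local Open Scope classical_set_scope.
Local Open Scope ring_scope.
Local Open Scope complex_scope.
Local Open Scope sesquilinear_scope.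

(** * Conjugate transposes and Gram matrices *)

Section ConjugateTranspose.
Variable C : numClosedFieldType.

Lemma trmxC_mul m n p (A : 'M[C]_(m, n)) (B : 'M_(n, p)) :
  (A *m B)^t* = B^t* *m A^t*.
Proof. by rewrite trmx_mul map_mxM. Qed.

Lemma trmxC1 n : (1%:M : 'M[C]_n)^t* = 1%:M.
Proof. by rewrite trmx1 map_mx1. Qed.

Lemma trmxC_tens m n p q (A : 'M[C]_(m, n)) (B : 'M_(p, q)) :
  (A *t B)^t* = A^t* *t B^t*.
Proof. by rewrite trmx_tens map_mxT. Qed.

Lemma mxtrace_gram m n (Z : 'M[C]_(m, n)) :
  \tr (Z *m Z^t*) = \sum_i \sum_j `|Z i j| ^+ 2.
Proof.
by apply: eq_bigr => i _; rewrite mxE; apply: eq_bigr => j _; rewrite !mxE normCK.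
Qed.

Lemma mxtrace_gram_ge0 m n (Z : 'M[C]_(m, n)) : 0 <= \tr (Z *m Z^t*).
Proof.
rewrite mxtrace_gram; apply: sumr_ge0 => i _; apply: sumr_ge0 => j _.
by rewrite exprn_ge0.
Qed.

Lemma mxtrace_gram_eq0 m n (Z : 'M[C]_(m, n)) : \tr (Z *m Z^t*) = 0 -> Z = 0.
Proof.
have sq_ge0 i j : 0 <= `|Z i j| ^+ 2 by rewrite exprn_ge0.
rewrite mxtrace_gram => /psumr_eq0P Z0; apply/matrixP => i j; rewrite mxE.
have /psumr_eq0P Zi0 : \sum_j `|Z i j| ^+ 2 = 0.
  by apply: Z0 => // k _; apply: sumr_ge0.
by apply/eqP; rewrite -normr_eq0 -sqrf_eq0 Zi0.
Qed.

End ConjugateTranspose.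

(** * Block matrices and the link product *)

Section Blocks.
Variable R : comNzRingType.

(** The partial matrix element of X between basis vectors i and j of the first factor. Since
    [idtens] acts on each such block separately, identities on composite systems are checked
    blockwise, through [blkP]. *)
Definition blk k l m n (X : 'M[R]_(k * m, l * n)) i j : 'M_(m, n) :=
  \matrix_(p, q) X (mxtens_index (i, p)) (mxtens_index (j, q)).

Lemma blkP k l m n (X Y : 'M[R]_(k * m, l * n)) :
  (forall i j, blk X i j = blk Y i j) -> X = Y.
Proof.
move=> XY; apply/matrixP => r s.
rewrite -(mxtens_unindexK r) -(mxtens_unindexK s).
case: (mxtens_unindex r) (mxtens_unindex s) => [i p] [j q].
by have /matrixP/(_ p q) := XY i j; rewrite !mxE.
Qed.

Lemma big_mxtens (V : nmodType) m n (F : 'I_(m * n) -> V) :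
  \sum_r F r = \sum_i \sum_p F (mxtens_index (i, p)).
Proof.
rewrite pair_bigA /= (reindex (@mxtens_index m n)) /=.
  by apply: eq_bigr => -[].
exists (@mxtens_unindex m n) => x _; [exact: mxtens_indexK|exact: mxtens_unindexK].
Qed.

Lemma blk_sum k l m n I r (P : pred I) (F : I -> 'M_(k * m, l * n)) i j :
  blk (\sum_(x <- r | P x) F x) i j = \sum_(x <- r | P x) blk (F x) i j.
Proof.
apply/matrixP => p q; rewrite mxE !summxE.
by apply: eq_bigr => x _; rewrite mxE.
Qed.

Lemma blkZ k l m n a (X : 'M_(k * m, l * n)) i j : blk (a *: X) i j = a *: blk X i j.
Proof. by apply/matrixP => p q; rewrite !mxE. Qed.

Lemma blk_mul k l h m n p (X : 'M_(k * m, l * n)) (Y : 'M_(l * n, h * p)) i j :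
  blk (X *m Y) i j = \sum_s blk X i s *m blk Y s j.
Proof.
apply/matrixP => a b; rewrite mxE mxE big_mxtens summxE; apply: eq_bigr => s _.
by rewrite mxE; apply: eq_bigr => q _; rewrite !mxE.
Qed.

Lemma blk_tens k l m n (A : 'M_(k, l)) (B : 'M_(m, n)) i j :
  blk (A *t B) i j = A i j *: B.
Proof. by apply/matrixP => p q; rewrite mxE tensmxE mxE. Qed.

Lemma blk_mul_tens1 k m n (A B : 'M_m) (X : 'M_(k * m, n * m)) i j :
  blk (1%:M *t A *m X *m (1%:M *t B)) i j = A *m blk X i j *m B.
Proof.
rewrite blk_mul (bigD1 j) //= big1 ?addr0 => [|s sj]; last first.
  by rewrite blk_tens mxE (negPf sj) scale0r mulmx0.
rewrite blk_tens mxE eqxx scale1r blk_mul (bigD1 i) //= big1 ?addr0 => [|s si].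
  by rewrite blk_tens mxE eqxx scale1r.
by rewrite blk_tens mxE eq_sym (negPf si) scale0r mul0mx.
Qed.

Lemma mxtrace_blk k m (X : 'M_(k * m)) : \tr X = \sum_i \tr (blk X i i).
Proof.
rewrite /mxtrace big_mxtens; apply: eq_bigr => i _.
by apply: eq_bigr => p _; rewrite mxE.
Qed.

Lemma mxtrace_mul_blk k m (X Y : 'M_(k * m)) :
  \tr (X *m Y) = \sum_i \sum_j \tr (blk X i j *m blk Y j i).
Proof.
rewrite mxtrace_blk; apply: eq_bigr => i _; rewrite blk_mul raddf_sum.
by [].
Qed.

(* The link product of a Choi operator Y with D: the image of D under the
   adjoint of the map with Choi operator Y, tensored with the identity. *)
Definition link e a b (Y : 'M[R]_(e * a)) (D : 'M_(e * b)) : 'M_(a * b) :=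
  \matrix_(r, s) \sum_x \sum_y
    Y (mxtens_index (x, (mxtens_unindex s).1)) (mxtens_index (y, (mxtens_unindex r).1))
    * D (mxtens_index (y, (mxtens_unindex r).2)) (mxtens_index (x, (mxtens_unindex s).2)).

(** The exchange of i and j between the two sides is the transpose that comes from acting on the
    purifying copy of A. *)
Lemma blk_link e a b (Y : 'M_(e * a)) (D : 'M_(e * b)) j i :
  blk (link Y D) j i = \sum_x \sum_y blk Y x y i j *: blk D y x.
Proof.
apply/matrixP => p q; rewrite !mxE !mxtens_indexK summxE; apply: eq_bigr => x _.
by rewrite summxE; apply: eq_bigr => y _; rewrite !mxE.
Qed.

Lemma link_suml e a b (I : finType) (F : I -> 'M_(e * a)) (D : 'M_(e * b)) :
  link (\sum_k F k) D = \sum_k link (F k) D.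
Proof.
apply: blkP => j i; rewrite blk_sum blk_link.
under [RHS]eq_bigr do rewrite blk_link.
rewrite [RHS]exchange_big; apply: eq_bigr => x _.
rewrite [RHS]exchange_big; apply: eq_bigr => y _.
by rewrite blk_sum summxE scaler_suml.
Qed.

Lemma linkBr e a b (Y : 'M_(e * a)) (D D' : 'M_(e * b)) :
  link Y (D - D') = link Y D - link Y D'.
Proof.
apply/matrixP => r s; rewrite !mxE -sumrB; apply: eq_bigr => x _.
by rewrite -sumrB; apply: eq_bigr => y _; rewrite !mxE mulrBr.
Qed.

End Blocks.

(** * Positive semidefinite matrices and square roots *)

Section Psd.
Variable R : realType.
Local Notation C := R[i].

Lemma psd_sum n (I : Type) (r : seq I) (P : pred I) (F : I -> 'M[C]_n) :
  (forall i, P i -> psd (F i)) -> psd (\sum_(i <- r | P i) F i).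
Proof.
move=> F_psd v; rewrite mulmx_sumr mulmx_suml summxE.
by apply: sumr_ge0 => i Pi; apply: F_psd.
Qed.

Lemma psdD n (A B : 'M[C]_n) : psd A -> psd B -> psd (A + B).
Proof.
by move=> A_psd B_psd v; rewrite mulmxDr mulmxDl mxE addr_ge0.
Qed.

Lemma psdZ n (a : C) (A : 'M[C]_n) : 0 <= a -> psd A -> psd (a *: A).
Proof.
by move=> a_ge0 A_psd v; rewrite -scalemxAr -scalemxAl mxE mulr_ge0.
Qed.

Lemma psd_conj m n (L : 'M[C]_(m, n)) (A : 'M_m) :
  psd A -> psd (L^t* *m A *m L).
Proof.
by move=> A_psd v; have := A_psd (L *m v); rewrite trmxC_mul !mulmxA.
Qed.

Lemma psd_gram m n (Z : 'M[C]_(m, n)) : psd (Z *m Z^t*).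
Proof.
move=> v; have := mxtrace_gram_ge0 (v^t* *m Z).
by rewrite trmxC_mul trmxCK mulmxA -trace_mx11 !mulmxA.
Qed.

Lemma psd_tr_projector n (Q : 'M[C]_n) : Q^t* = Q -> Q *m Q = Q -> psd Q^T.
Proof.
move=> Q_herm Q_idem; suff -> : Q^T = Q^T *m (Q^T)^t* by apply: psd_gram.
by rewrite -[X in _ *m X]map_trmx Q_herm -trmx_mul Q_idem.
Qed.

(** Polarization: expanding the form at u + v gives f u v + f v u = 0. At two basis vectors this
    reads B j i = - B i j; multiplying the second vector by the imaginary unit gives B i j = B j i,
    so both vanish. *)
Lemma sesqui_form_eq0 n (B : 'M[C]_n) :
  (forall v : 'cV_n, (v^t* *m B *m v) 0 0 = 0) -> B = 0.
Proof.
move=> B0; pose f (u v : 'cV_n) := (u^t* *m B *m v) 0 0.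
have polar u v : f u v + f v u = 0.
  have := B0 (u + v); rewrite [(u + v)^T]linearD map_mxD !mulmxDl !mulmxDr !mxE.
  have := B0 u; have := B0 v; rewrite /f !mxE => -> ->.
  by rewrite add0r addr0.
have fE i j : f (delta_mx i 0) (delta_mx j 0) = B i j.
  by rewrite /f trmx_delta map_delta_mx -rowE -colE !mxE.
have fZr a u v : f u (a *: v) = a * f u v by rewrite /f -scalemxAr mxE.
have fZl a u v : f (a *: u) v = a^* * f u v.
  by rewrite /f [(a *: u)^T]linearZ map_mxZ -!scalemxAl mxE.
apply/matrixP => i j; rewrite mxE.
have /eqP := polar (delta_mx i 0) ('i *: delta_mx j 0).
have := polar (delta_mx i 0) (delta_mx j 0).
rewrite fZr fZl !fE conjCi => Bij.
have -> : B j i = - B i j by apply/eqP; rewrite -addr_eq0 addrC Bij.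
by rewrite mulrNN -mulr2n mulrn_eq0 /= mulf_eq0 (negPf (neq0Ci _)) => /eqP.
Qed.

(** The quadratic form of A is real, so it agrees with the form of the adjoint, and over the complex
    numbers the form determines the matrix. *)
Lemma psd_herm n (A : 'M[C]_n) : psd A -> A^t* = A.
Proof.
move=> A_psd; apply/eqP; rewrite -subr_eq0; apply/eqP/sesqui_form_eq0 => v.
have /ger0_real/CrealP vAv_real := A_psd v.
rewrite mulmxBr mulmxBl [LHS]mxE [X in _ + X]mxE; apply/eqP; rewrite subr_eq0.
rewrite -[X in _ == X]vAv_real; apply/eqP.
transitivity ((v^t* *m A *m v)^t* 0 0); last by rewrite 2!mxE.
by rewrite !trmxC_mul trmxCK mulmxA.
Qed.

(** A is Hermitian, hence normal and unitarily diagonalizable; each eigenvalue is the value of the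
    form at a column of [U^t*]. *)
Lemma psd_spectral n (A : 'M[C]_n) (U := spectralmx A) : psd A ->
  A = U^t* *m diag_mx (spectral_diag A) *m U /\ forall i, 0 <= spectral_diag A 0 i.
Proof.
move=> A_psd.
have U_unitary : U \is unitarymx by apply: spectral_unitarymx.
have AE : A = U^t* *m diag_mx (spectral_diag A) *m U.
  rewrite -invmx_unitary //; apply/orthomx_spectralP/normalmxP.
  by rewrite psd_herm.
split=> // i; have := psd_conj (U^t*) A_psd (delta_mx i 0).
rewrite {1}AE trmxCK !mulmxA !(mulmxtVK _ U_unitary).
by rewrite trmx_delta map_delta_mx -rowE -colE !mxE eqxx.
Qed.

(** All the matrices involved are functions [f g] of the eigenvalues in one eigenbasis, so they
    multiply pointwise. The pseudo-inverse S' allows for a singular A. *)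
Lemma sqrtmx_pinv n (A : 'M[C]_n) (S := sqrtmx A) : psd A ->
  [/\ S *m S = A, S^t* = S & exists S' : 'M_n,
    [/\ S'^t* = S', S *m S' = S' *m S & S *m S' *m S = S]].
Proof.
move=> A_psd; have [AE d_ge0] := psd_spectral A_psd.
set U := spectralmx A in AE; set d := spectral_diag A in AE d_ge0.
have U_unitary : U \is unitarymx by apply: spectral_unitarymx.
pose f (g : 'rV[C]_n) := U^t* *m diag_mx g *m U.
have fM g h : f g *m f h = f (\row_i (g 0 i * h 0 i)).
  rewrite /f !mulmxA (mulmxtVK _ U_unitary) -(mulmxA _ (diag_mx g)).
  by rewrite mulmx_diag.
have f_herm (g : 'rV[C]_n) : (forall i, 0 <= g 0 i) -> (f g)^t* = f g.
  move=> g_ge0; rewrite /f !trmxC_mul trmxCK tr_diag_mx map_diag_mx mulmxA.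
  congr (_ *m diag_mx _ *m _); apply/rowP => i; rewrite mxE.
  exact: geC0_conj.
have SE : S = f (map_mx sqrtC d) by rewrite /S /sqrtmx invmx_unitary.
have s_ge0 i : 0 <= (map_mx sqrtC d) 0 i by rewrite mxE sqrtC_ge0.
split.
- rewrite SE fM AE; congr (_ *m diag_mx _ *m _).
  by apply/rowP => i; rewrite !mxE -expr2 sqrtCK.
- by rewrite SE f_herm.
(* As 0^-1 = 0, this inverts the nonzero eigenvalues of S and leaves its kernel in place. *)
exists (f (map_mx (fun z => (sqrtC z)^-1) d)); split.
- by rewrite f_herm // => i; rewrite mxE invr_ge0 sqrtC_ge0.
- by rewrite SE !fM; congr f; apply/rowP => i; rewrite !mxE mulrC.
rewrite SE !fM; congr f; apply/rowP => i; rewrite !mxE.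
have [->|d0] := eqVneq (d 0 i) 0; first by rewrite sqrtC0 mulr0.
by rewrite mulfV ?mul1r // sqrtC_eq0.
Qed.

Lemma psd_gramP n (A : 'M[C]_n) : psd A -> exists Z : 'M_n, A = Z *m Z^t*.
Proof. by case/sqrtmx_pinv => AE S_herm _; exists (sqrtmx A); rewrite S_herm. Qed.

(** With Y = Z Z^*, each column k of Z reshapes to a matrix [Zk k], and these are Kraus operators:
    the link is the sum of the conjugates of D by [Zk k *t 1%:M]. *)
Lemma psd_link e a b (Y : 'M[C]_(e * a)) (D : 'M_(e * b)) :
  psd Y -> psd D -> psd (link Y D).
Proof.
move=> /psd_gramP[Z YE] D_psd.
pose Zk k : 'M_(e, a) := \matrix_(x, i) Z (mxtens_index (x, i)) k.
suff -> : link Y D = \sum_k (Zk k *t 1%:M)^t* *m D *m (Zk k *t 1%:M).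
  by apply: psd_sum => k _; apply: psd_conj.
apply: blkP => j i; rewrite blk_sum blk_link.
transitivity (\sum_x \sum_y \sum_k (Z (mxtens_index (x, i)) k
    * (Z (mxtens_index (y, j)) k)^*) *: blk D y x).
  apply: eq_bigr => x _; apply: eq_bigr => y _.
  rewrite -scaler_suml; congr (_ *: _); rewrite YE !mxE.
  by apply: eq_bigr => k _; rewrite !mxE.
under eq_bigr do rewrite exchange_big.
rewrite exchange_big; apply: eq_bigr => k _.
rewrite blk_mul; apply: eq_bigr => x _; rewrite blk_mul mulmx_suml.
apply: eq_bigr => y _; rewrite trmxC_tens trmxC1 !blk_tens !mxE.
by rewrite -scalemxAl mul1mx -scalemxAr mulmx1 scalerA.
Qed.

End Psd.

(** * Trace identities for the purification and the link product *)

Section LinkTraces.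
Variable R : realType.
Local Notation C := R[i].

Lemma blk_idtens k m n (N : 'M[C]_m -> 'M[C]_n) (X : 'M_(k * m)) i j :
  blk (idtens N X) i j = N (blk X i j).
Proof.
apply/matrixP => p q; rewrite !mxE !mxtens_indexK /=.
by congr (N _ p q); apply/matrixP => a b; rewrite !mxE.
Qed.

Lemma ptrace1_blk m n (X : 'M[C]_(m * n)) : ptrace1 X = \sum_i blk X i i.
Proof.
by apply/matrixP => p q; rewrite mxE summxE; apply: eq_bigr => i _; rewrite mxE.
Qed.

Lemma ptrace2_blk m n (X : 'M[C]_(m * n)) i j : ptrace2 X i j = \tr (blk X i j).
Proof. by rewrite mxE; apply: eq_bigr => p _; rewrite mxE. Qed.

Lemma ptrace1_mul_tens1 m n (A B : 'M[C]_n) (X : 'M_(m * n)) :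
  ptrace1 (1%:M *t A *m X *m (1%:M *t B)) = A *m ptrace1 X *m B.
Proof.
rewrite !ptrace1_blk mulmx_sumr mulmx_suml.
by apply: eq_bigr => i _; rewrite blk_mul_tens1.
Qed.

Lemma ptrace1_sum m n (I : finType) (F : I -> 'M[C]_(m * n)) :
  ptrace1 (\sum_k F k) = \sum_k ptrace1 (F k).
Proof.
rewrite ptrace1_blk; under [RHS]eq_bigr do rewrite ptrace1_blk.
by rewrite exchange_big; apply: eq_bigr => i _; rewrite blk_sum.
Qed.

Lemma mxtrace_ptrace1 m n (X : 'M[C]_(m * n)) : \tr (ptrace1 X) = \tr X.
Proof. by rewrite ptrace1_blk raddf_sum mxtrace_blk. Qed.

Lemma mxtrace_ptrace2 m n (X : 'M[C]_(m * n)) : \tr (ptrace2 X) = \tr X.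
Proof. by rewrite mxtrace_blk; apply: eq_bigr => i _; rewrite ptrace2_blk. Qed.

Lemma mxtrace_tens m n (A : 'M[C]_m) (B : 'M_n) : \tr (A *t B) = \tr A * \tr B.
Proof.
rewrite mxtrace_blk mulr_suml; apply: eq_bigr => i _.
by rewrite blk_tens mxtraceZ.
Qed.

Lemma blk_purification n (rho : 'M[C]_n) i j :
  blk (purification rho) i j = sqrtmx rho *m delta_mx i j *m sqrtmx rho.
Proof.
rewrite blk_mul_tens1; congr (_ *m _ *m _); rewrite /Phi blk_sum.
under eq_bigr => k _.
  rewrite blk_sum; under eq_bigr do rewrite blk_tens mxE.
  over.
rewrite (bigD1 i) //= [X in _ + X]big1 ?addr0 => [|k ki]; last first.
  by apply: big1 => l _; rewrite eq_sym (negPf ki) scale0r.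
rewrite (bigD1 j) //= big1 ?addr0 ?eqxx ?scale1r // => k kj.
by rewrite eq_sym (negPf kj) andbF scale0r.
Qed.

Lemma tens1mx m n : (1%:M : 'M[C]_m) *t (1%:M : 'M_n) = 1%:M.
Proof.
apply: blkP => i j; rewrite blk_tens; apply/matrixP => p q; rewrite !mxE.
by rewrite (inj_eq (can_inj (@mxtens_indexK m n))) xpair_eqE -natrM mulnb.
Qed.

Lemma tensmxBl m n p q (A A' : 'M[C]_(m, n)) (B : 'M_(p, q)) :
  (A - A') *t B = A *t B - A' *t B.
Proof. by apply/matrixP => i j; rewrite !mxE mulrBl. Qed.

Lemma tensmxBr m n p q (A : 'M[C]_(m, n)) (B B' : 'M_(p, q)) :
  A *t (B - B') = A *t B - A *t B'.
Proof. by apply/matrixP => i j; rewrite !mxE mulrBr. Qed.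

(** The adjoint map at the identity; its distance from 1 measures how far the steering measurement
    is from being complete. *)
Lemma link1r e a b (Y : 'M[C]_(e * a)) :
  link Y (1%:M : 'M_(e * b)) = (ptrace1 Y)^T *t 1%:M.
Proof.
rewrite -tens1mx.
apply: blkP => j i; rewrite blk_link blk_tens mxE ptrace1_blk summxE scaler_suml.
apply: eq_bigr => x _; rewrite (bigD1 x) //= [X in _ + X]big1 ?addr0 => [|y yx].
  by rewrite blk_tens [_%:M x x]mxE eqxx scale1r.
by rewrite blk_tens [_%:M y x]mxE (negPf yx) scale0r scaler0.
Qed.

Lemma psd_tens1 m n (A : 'M[C]_m) : psd A -> psd (A *t (1%:M : 'M_n)).
Proof.
move=> /psd_gramP[Z ->].
suff -> : (Z *m Z^t*) *t 1%:M = (Z *t 1%:M) *m (Z *t (1%:M : 'M_n))^t*.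
  exact: psd_gram.
by rewrite trmxC_tens trmxC1 tensmx_mul mulmx1.
Qed.

(** Block (i, j) of the purification is S |i><j| S with S the root of rho. The link weights it by
    the entry (i, j) of [blk Y x y], so by linearity of N the sum over i and j rebuilds N of S
    [blk Y x y] S, which is N of [blk X x y]. *)
Lemma mxtrace_idtens_link e a b (N : {linear 'M[C]_a -> 'M[C]_b}) (rho : 'M_a)
    (X Y : 'M_(e * a)) (D : 'M_(e * b)) :
    (forall x y, blk X x y = sqrtmx rho *m blk Y x y *m sqrtmx rho) ->
  \tr (idtens N (purification rho) *m link Y D) = \tr (idtens N X *m D).
Proof.
move=> XY; rewrite !mxtrace_mul_blk.
transitivity (\sum_i \sum_j \sum_x \sum_y
    blk Y x y i j * \tr (N (blk (purification rho) i j) *m blk D y x)).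
  apply: eq_bigr => i _; apply: eq_bigr => j _; rewrite blk_idtens blk_link.
  rewrite mulmx_sumr raddf_sum; apply: eq_bigr => x _.
  rewrite mulmx_sumr raddf_sum; apply: eq_bigr => y _.
  by rewrite -scalemxAr /= mxtraceZ.
under eq_bigr do rewrite exchange_big.
rewrite exchange_big; apply: eq_bigr => x _.
under eq_bigr do rewrite exchange_big.
rewrite exchange_big; apply: eq_bigr => y _.
rewrite blk_idtens XY [in RHS](matrix_sum_delta (blk Y x y)).
rewrite mulmx_sumr mulmx_suml raddf_sum mulmx_suml raddf_sum.
apply: eq_bigr => i _; rewrite mulmx_sumr mulmx_suml raddf_sum mulmx_suml raddf_sum.
apply: eq_bigr => j _; rewrite blk_purification -scalemxAr -scalemxAl /= linearZ_LR.
by rewrite -scalemxAl /= mxtraceZ.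
Qed.

(** Discard the input and prepare sigma. Seen as the output of this map, the product alternative
    obeys the same link identity as the output of the channel. *)
Definition trace_replace m n (sigma : 'M[C]_n) (Z : 'M[C]_m) : 'M[C]_n :=
  \tr Z *: sigma.

Lemma trace_replace_is_linear m n (sigma : 'M[C]_n) :
  linear (@trace_replace m n sigma).
Proof.
by move=> a X Y; rewrite /trace_replace mxtraceD mxtraceZ scalerDl scalerA.
Qed.

HB.instance Definition _ m n (sigma : 'M[C]_n) :=
  GRing.isLinear.Build C 'M[C]_m 'M[C]_n *:%R (@trace_replace m n sigma)
    (@trace_replace_is_linear m n sigma).

Lemma ptrace2_tens k m n (X : 'M[C]_(k * m)) (sigma : 'M_n) :
  ptrace2 X *t sigma = idtens (@trace_replace m n sigma) X.
Proof. by apply: blkP => i j; rewrite blk_tens blk_idtens ptrace2_blk. Qed.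

Lemma mxtrace_replacement_link e a b (rho : 'M[C]_a)
    (X Y : 'M_(e * a)) (D : 'M_(e * b)) (sigma : 'M_b) :
    (forall x y, blk X x y = sqrtmx rho *m blk Y x y *m sqrtmx rho) ->
  \tr ((ptrace2 (purification rho) *t sigma) *m link Y D)
    = \tr ((ptrace2 X *t sigma) *m D).
Proof. by move=> XY; rewrite !ptrace2_tens (mxtrace_idtens_link _ _ XY). Qed.

End LinkTraces.

(** * Steering: obtaining an ensemble from the purification *)

Section Steering.
Variable R : realType.
Local Notation C := R[i].
Variables (I : finType) (e a : nat) (X : I -> 'M[C]_(e * a)).
Hypothesis X_psd : forall w, psd (X w).

(** With W = 1 (x) Q, the nonnegative traces of W X_v W add up to the trace of Q rho Q = 0, so each
    is zero. Writing X_w = Z Z^*, this is the squared norm of W Z, whence W Z = 0. *)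
Lemma ptrace1_kernel (Q : 'M[C]_a) : Q^t* = Q ->
  Q *m (\sum_w ptrace1 (X w)) = 0 -> forall w, 1%:M *t Q *m X w = 0.
Proof.
move=> Q_herm Qrho w; pose W : 'M_(e * a) := 1%:M *t Q.
have W_herm : W^t* = W by rewrite trmxC_tens trmxC1 Q_herm.
have gramE (Z : 'M_(e * a)) : W *m (Z *m Z^t*) *m W = W *m Z *m (W *m Z)^t*.
  by rewrite trmxC_mul W_herm !mulmxA.
have tr_ge0 v : 0 <= \tr (W *m X v *m W).
  by have [Z ->] := psd_gramP (X_psd v); rewrite gramE mxtrace_gram_ge0.
have /psumr_eq0P tr0 : \sum_v \tr (W *m X v *m W) = 0.
  under eq_bigr do rewrite -mxtrace_ptrace1 ptrace1_mul_tens1.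
  by rewrite -raddf_sum -mulmx_suml -mulmx_sumr Qrho mul0mx raddf0.
have := tr0 (fun v _ => tr_ge0 v) w isT; have [Z ->] := psd_gramP (X_psd w).
rewrite gramE => /mxtrace_gram_eq0 WZ.
by rewrite -/W mulmxA WZ mul0mx.
Qed.

(* Any decomposition of an extension of rho is obtained by acting on the system
   purifying rho; the Y w are the Choi operators of that (trace-nonincreasing)
   instrument. *)
Lemma steering (rho := \sum_w ptrace1 (X w)) : psd rho ->
  exists Y : I -> 'M[C]_(e * a),
  [/\ forall w, psd (Y w), psd (1%:M - \sum_w ptrace1 (Y w))^T &
      forall w x y, blk (X w) x y = sqrtmx rho *m blk (Y w) x y *m sqrtmx rho].
Proof.
move=> /sqrtmx_pinv; set S := sqrtmx rho.
(* [P] is the orthogonal projector onto the support of rho, where S' inverts S. *)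
move=> [SS S_herm [S' [S'_herm S'C SS'S]]]; pose P := S *m S'.
have P_herm : P^t* = P by rewrite trmxC_mul S_herm S'_herm.
have PP : P *m P = P by rewrite /P mulmxA SS'S.
have P_rho : (1%:M - P) *m rho = 0.
  by rewrite -SS mulmxA mulmxBl mul1mx SS'S subrr mul0mx.
have Q_herm : (1%:M - P)^t* = 1%:M - P.
  by rewrite [(_ - _)^T]linearB map_mxB trmxC1 P_herm.
(* [X w] lives on the support of rho, because 1 - P annihilates rho. *)
have PX w : 1%:M *t P *m X w = X w.
  apply/eqP; rewrite eq_sym -subr_eq0; apply/eqP.
  rewrite -(ptrace1_kernel Q_herm P_rho w).
  by rewrite tensmxBr tens1mx mulmxBl mul1mx.
have XP w : X w *m (1%:M *t P) = X w.
  by rewrite -[RHS](psd_herm (X_psd w)) -[in RHS]PX trmxC_mul trmxC_tens trmxC1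
    P_herm (psd_herm (X_psd w)).
(* Conjugation by S' undoes the two square roots that the purification inserts; on the support of
   rho nothing is lost. *)
exists (fun w => 1%:M *t S' *m X w *m (1%:M *t S')); split=> [w||w x y].
- rewrite -[X in X *m _ *m _](_ : (1%:M *t S')^t* = _); first exact: psd_conj.
  by rewrite trmxC_tens trmxC1 S'_herm.
(* The marginals add up to S' rho S' = P, and 1 - P is a projector. *)
- under eq_bigr do rewrite ptrace1_mul_tens1.
  rewrite -mulmx_suml -mulmx_sumr -/rho -SS.
  have -> : S' *m (S *m S) *m S' = P.
    by rewrite mulmxA -S'C SS'S.
  apply: psd_tr_projector => //.
  by rewrite mulmxBl mul1mx mulmxBr mulmx1 PP subrr subr0.
rewrite -/S; clearbody S.
rewrite blk_mul_tens1 !mulmxA -/P -mulmxA -S'C -/P -blk_mul_tens1.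
by rewrite PX XP.
Qed.

End Steering.

Lemma Re_sum (R : realType) (I : finType) (F : I -> R[i]) :
  complex.Re (\sum_k F k) = \sum_k complex.Re (F k).
Proof. exact: raddf_sum. Qed.

(** * The test built from a code *)

Section CodeTest.
Variables (R : realType) (dA dB M : nat).
Local Notation C := R[i].
Variables (K : ea_code R dA dB M) (E : {linear 'M[C]_dA -> 'M[C]_dB}).

Lemma psd_encoded w : psd (encoded K w).
Proof. by have [cp _] := enc_cptp K w; apply/cp/(shared_state K).1. Qed.

(** No signalling: a trace-preserving encoder on the sender's half leaves the receiver's share
    unchanged, whatever the message. *)
Lemma ptrace2_encoded w : ptrace2 (encoded K w) = ptrace2 (shared K).
Proof.
have [_ tp] := enc_cptp K w.
by apply/matrixP => i j; rewrite !ptrace2_blk blk_idtens tp.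
Qed.

Lemma mxtrace_idtens k m n (N : {linear 'M[C]_m -> 'M[C]_n}) (X : 'M_(k * m)) :
  cptp N -> \tr (idtens N X) = \tr X.
Proof.
case=> _ tp; rewrite !mxtrace_blk.
by apply: eq_bigr => i _; rewrite blk_idtens tp.
Qed.

Lemma sum_prob w : cptp E -> \sum_what prob K E what w = 1.
Proof.
move=> E_cptp; rewrite /prob -Re_sum -(raddf_sum (@mxtrace C _)) -mulmx_suml.
rewrite dec_sum mul1mx /= mxtrace_idtens // mxtrace_idtens; last exact: enc_cptp.
by rewrite (shared_state K).2.
Qed.

Lemma error_probE : cptp E -> (0 < M)%N ->
  error_prob K E = 1 - M%:R^-1 * \sum_w prob K E w w.
Proof.
move=> E_cptp M_gt0; rewrite /error_prob.
under eq_bigr => w _.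
  rewrite (_ : \sum_(what | _) _ = 1 - prob K E w w); last first.
    by rewrite -(sum_prob w E_cptp) [in RHS](bigD1 w) //= addrAC subrr add0r.
  over.
rewrite sumrB sumr_const card_ord mulrBr mulVf //.
by rewrite pnatr_eq0 -lt0n.
Qed.

(** Rejection splits into two positive parts: the steering measurement gives no outcome, or it gives
    w and the decoder outputs something else. *)
Lemma psd_link_dec (Y : 'I_M -> 'M[C]_(dBE K * dA)) :
    (forall w, psd (Y w)) -> psd (1%:M - \sum_w ptrace1 (Y w))^T ->
  psd (1%:M - \sum_w link (Y w) (dec K w)).
Proof.
move=> Y_psd Y_sub.
have -> : 1%:M - \sum_w link (Y w) (dec K w) =
    (1%:M - \sum_w ptrace1 (Y w))^T *t 1%:M
    + \sum_w link (Y w) (1%:M - dec K w).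
  under [X in _ = _ + X]eq_bigr do rewrite linkBr.
  rewrite sumrB -link_suml link1r ptrace1_sum.
  by rewrite [(_ - _)^T]linearB /= trmx1 tensmxBl tens1mx addrA subrK.
apply: psdD; first exact: psd_tens1.
apply: psd_sum => w _; apply: psd_link => //.
rewrite -(dec_sum K) (bigD1 w) //= addrAC subrr add0r.
by apply: psd_sum => v _; apply: dec_psd.
Qed.

Lemma code_test (rho : 'M[C]_dA) : psd rho -> avg_input K = rho ->
  exists T, [/\ psd T, psd (1%:M - T),
    \tr (idtens E (purification rho) *m T)
      = M%:R^-1 * \sum_w \tr (dec K w *m idtens E (encoded K w)) &
    forall sigma, \tr ((ptrace2 (purification rho) *t sigma) *m T)
      = M%:R^-1 * \tr sigma].
Proof.
(* The weight 1/M is put into [X w], so that the marginals add up to rho itself. *)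
move=> rho_psd avgE; pose X w : 'M[C]_(dBE K * dA) := M%:R^-1 *: encoded K w.
have ptrace1Z (Z : 'M[C]_(dBE K * dA)) : ptrace1 (M%:R^-1 *: Z) = M%:R^-1 *: ptrace1 Z.
  rewrite !ptrace1_blk scaler_sumr.
  by apply: eq_bigr => i _; rewrite blkZ.
have idtensZ n (N : {linear 'M[C]_dA -> 'M[C]_n}) (Z : 'M[C]_(dBE K * dA)) :
    idtens N (M%:R^-1 *: Z) = M%:R^-1 *: idtens N Z.
  by apply: blkP => i j; rewrite blkZ !blk_idtens blkZ linearZ_LR.
have rhoE : \sum_w ptrace1 (X w) = rho.
  rewrite -avgE /avg_input scaler_sumr.
  by apply: eq_bigr => w _; rewrite ptrace1Z.
have X_psd w : psd (X w) by apply: psdZ; [rewrite invr_ge0 ler0n|apply: psd_encoded].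
have := steering X_psd; rewrite rhoE => /(_ rho_psd) [Y [Y_psd Y_sub XY]].
(* Steer to a message w and accept when the decoder outputs w. *)
exists (\sum_w link (Y w) (dec K w)); split.
- by apply: psd_sum => w _; apply: psd_link => //; apply: dec_psd.
- exact: psd_link_dec.
- rewrite mulmx_sumr raddf_sum mulr_sumr; apply: eq_bigr => w _ /=.
  rewrite (mxtrace_idtens_link _ _ (XY w)) idtensZ -scalemxAl mxtraceZ.
  by rewrite mxtrace_mulC.
move=> sigma; rewrite mulmx_sumr raddf_sum.
transitivity (\sum_w M%:R^-1 * \tr ((ptrace2 (shared K) *t sigma) *m dec K w)).
  apply: eq_bigr => w _ /=.
  rewrite (mxtrace_replacement_link _ _ (XY w)) ptrace2_tens idtensZ.
  by rewrite -scalemxAl mxtraceZ -ptrace2_tens ptrace2_encoded.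
(* The state is now the same for every w, so the decoding operators add up to the identity. *)
rewrite -mulr_sumr -raddf_sum -mulmx_sumr dec_sum mulmx1 /= mxtrace_tens.
by rewrite mxtrace_ptrace2 (shared_state K).2 mul1r.
Qed.

End CodeTest.

(** * Logarithmic bounds on the code size *)

Section LogSize.
Variable R : realType.
Local Notation C := R[i].

(** [ME_input] and [ME] are suprema of sizes, not of logarithms; with this lemma each M is bounded
    by an exponential first and the logarithm is taken last. At y <= 0 the value of [lne] is -oo. *)
Lemma lne_le_expeR (x y : \bar R) : (y <= expeR x -> lne y <= x)%E.
Proof.
move=> yx; have [y0|y0] := leP y 0%E; first by rewrite le0_lneNy // leNye.
rewrite -(expeRK x) lee_lne // in_itv /= leey andbT; last exact: expeR_ge0.
exact: ltW.
Qed.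

Lemma has_code_DALL dA dB (E : {linear 'M[C]_dA -> 'M[C]_dB}) (eps : R)
    (rho : 'M[C]_dA) (sigma : 'M_dB) M :
    cptp E -> states rho -> states sigma -> has_code eps E rho M ->
  (M%:R%:E <= expeR (DALL eps (idtens E (purification rho))
                       (ptrace2 (purification rho) *t sigma)))%E.
Proof.
move=> E_cptp [rho_psd _] [_ tr_sigma] [M_gt0 [K [err avgE]]].
have [T [T_psd T_le1 T_null T_alt]] := code_test E rho_psd avgE.
have M_pos : 0 < M%:R :> R by rewrite ltr0n.
have ReM (z : C) : complex.Re (M%:R^-1 * z) = M%:R^-1 * complex.Re z.
  have -> : M%:R^-1 = (M%:R^-1)%:C :> C by rewrite fmorphV rmorph_nat.
  by case: z => x y /=; rewrite mul0r subr0.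
have beta_le : (betaALL eps (idtens E (purification rho))
    (ptrace2 (purification rho) *t sigma) <= (M%:R^-1)%:E)%E.
  apply: ereal_inf_lbound; exists T; last first.
    by rewrite T_alt ReM tr_sigma mulr1.
  (* Acceptance on the channel output is 1 - [error_prob], which makes T feasible. *)
  split=> //; rewrite T_null ReM Re_sum.
  by move: err; rewrite error_probE // !lerBlDr addrC.
have -> : (M%:R)%:E = expeR (- lne (M%:R^-1)%:E)%E :> \bar R.
  by rewrite lneV // oppeK lne_EFin //= lnK.
(* This form also covers a vanishing [betaALL], for which [DALL] is +oo. *)
rewrite lee_expeR leeNr oppeK; apply: lne_le_expeR.
by rewrite lneK // in_itv /= leey lee_fin invr_ge0 ler0n.
Qed.

Lemma has_code_IALL dA dB (E : {linear 'M[C]_dA -> 'M[C]_dB}) (eps : R)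
    (rho : 'M[C]_dA) M :
    cptp E -> states rho -> has_code eps E rho M ->
  (M%:R%:E <= expeR (IALL eps E rho))%E.
Proof.
move=> E_cptp rho_state code.
have -> : (M%:R)%:E = expeR (lne (M%:R)%:E) :> \bar R.
  by rewrite lneK // in_itv /= leey lee_fin ler0n.
rewrite lee_expeR; apply: le_ereal_inf_tmp => _ [sigma sigma_state <-].
by apply: lne_le_expeR; apply: has_code_DALL.
Qed.

End LogSize.

Theorem theorem18 (R : realType) (dA dB : nat)
    (E : {linear 'M[R[i]]_dA -> 'M[R[i]]_dB}) (hE : cptp E)
    (eps : R) (heps : 0 <= eps <= 1) :
  (forall rho : 'M[R[i]]_dA, states rho ->
     (lne (ME_input eps E rho) <= IALL eps E rho)%E) /\
  (lne (ME eps E) <= ereal_sup [set IALL eps E rho | rho in @states R dA])%E.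
Proof.
split=> [rho rho_state|].
  apply/lne_le_expeR/ge_ereal_sup => _ [M code <-].
  exact: has_code_IALL.
apply/lne_le_expeR/ge_ereal_sup => _ [M [rho rho_state code] <-].
apply: le_trans (has_code_IALL hE rho_state code) _.
by rewrite lee_expeR; apply: ereal_sup_ubound; exists rho.
Qed.
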